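(* Let $R$ be a discrete valuation ring, let $A$ be a reduced countably generated torsion $R$-module, and let $G$ be the group of $R$-module automorphisms of $A$. Let $a,b\in A$. Then (1) $a$ degenerates to $b$ if and only if the Ulm sequence of $b$ dominates the Ulm sequence of $a$ term-wise, i.e. $h(p^ib)\geq h(p^ia)$ for all $i\geq 0$; (2) $a$ and $b$ lie in the same $G$-orbit if and only if their Ulm sequences coincide.
   Context: A module is reduced if it has no nonzero divisible submodule. Let $p$ be a generator of the maximal ideal of $R$. Height: define submodules $A_\alpha$ for ordinals $\alpha$ by $A_0=A$, $A_{\beta+1}=pA_\beta$, and $A_\alpha=\bigcap_{\beta<\alpha}A_\beta$ for limit ordinals $\alpha$. A nonzero $a\in A$ has height $h(a)=\alpha$ if $a\in A_\alpha$ and $a\notin A_{\alpha+1}$; and $h(0)=\infty$, where $\infty$ is a symbol greater than every ordinal. The Ulm sequence of $a\in A$ is the sequence $\{h_i\}_{i\geq 0}$ with $h_i=h(p^ia)$. Degeneration: $a$ degenerates to $b$ if there is an $R$-module endomorphism $\phi$ of $A$ with $\phi(a)=b$. *)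

(* Defs.v *)
From HB Require Import structures.
From mathcomp Require Import all_boot all_order all_algebra.
From mathcomp Require Import boolp classical_sets cardinality.

Set Implicit Arguments.
Unset Strict Implicit.
Unset Printing Implicit Defensive.

Import GRing.Theory.
Local Open Scope classical_set_scope.
Local Open Scope ring_scope.

(* Ordinals as transfinitely branching trees: [osup f] denotes the least upper
   bound of the ordinals [f i], so that every limit ordinal is an [osup].
   Distinct trees may denote the same ordinal; equality of ordinals is [oeq].
   Classically [olt] is a well-founded total order up to [oeq]: see
   [ole_trans], [ole_total] and [olt_wf] below. *)
Inductive Ord : Type :=
| ozero : Ord
| osucc : Ord -> Ord
| osup : forall I : Type, (I -> Ord) -> Ord.

(* The inner fixpoint is [olt a']. *)
Fixpoint ole (a : Ord) : Ord -> Prop :=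
  match a with
  | ozero => fun=> True
  | osucc a' => fix lt (b : Ord) : Prop :=
      match b with
      | ozero => False
      | osucc b' => ole a' b'
      | osup _ g => exists i, lt (g i)
      end
  | osup _ f => fun b => forall i, ole (f i) b
  end.

Definition olt (a b : Ord) : Prop := ole (osucc a) b.

Definition oeq (a b : Ord) : Prop := ole a b /\ ole b a.

Definition olimit (a : Ord) : Prop :=
  olt ozero a /\ forall b, olt b a -> olt (osucc b) a.

Lemma ole_osup a I (g : I -> Ord) i : ole a (g i) -> ole a (osup g).
Proof.
elim: a => [//|a _|J f IH] /= h; first by exists i.
by move=> j; apply: IH.
Qed.

Lemma ole_osucc a b : ole a b -> ole a (osucc b).
Proof.
elim: a b => [//|a IH|J f IH] b.
- elim: b => [//|b _|J g IHg] /=; first exact: IH.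
  by case=> i /IHg h; apply: (ole_osup (i := i)).
- by move=> h i; apply: IH.
Qed.

Lemma olt_ole a b : olt a b -> ole a b.
Proof.
elim: b => [//|b _|J g IHg]; first exact: ole_osucc.
by case=> i /IHg; apply: ole_osup.
Qed.

Lemma ole_refl a : ole a a.
Proof.
elim: a => [//|//|I f IH] i.
exact: ole_osup (IH i).
Qed.

Lemma ole_trans a b c : ole a b -> ole b c -> ole a c.
Proof.
elim: b a c => [|b IHb|J g IHg] a c.
- elim: a => [//|//|I f IH] h _ i; exact: IH.
- elim: a => [//|a _|I f IH] h hb; last by move=> i; apply: IH.
  elim: c hb => [//|c _|K k IHk] /=; first exact: IHb.
  by case=> i hi; exists i; apply: IHk.
- elim: a => [//|a _|I f IH] h hg; last by move=> i; apply: IH.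
  by case: h => i hi; apply: (IHg i).
Qed.

Lemma ole_total a b : ole a b \/ olt b a.
Proof.
have sup_case I (f : I -> Ord) c :
    (forall i, ole (f i) c \/ olt c (f i)) ->
    (forall i, ole (f i) c) \/ exists i, olt c (f i).
  move=> h; have [|/existsNP[i hi]] := pselect (forall i, ole (f i) c).
    by left.
  by right; exists i; case: (h i).
suff: (ole a b \/ olt b a) /\ (ole b a \/ olt a b) by case.
elim: a b => [|a IHa|I f IHf] b; split.
- by left.
- elim: b => [|b _|J g IHg]; [by left|by right|exact: sup_case].
- by case: (IHa b) => _ [h|h]; [right|left].
- elim: b => [|b _|J g IHg]; first by left.
    by case: (IHa b) => _ [h|h]; [left|right].
  exact: sup_case.
- by apply: sup_case => i; have [] := IHf i b.
- elim: b => [|b _|J g IHg]; first by left.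
    have [h|h] := sup_case _ _ _ (fun i => proj1 (IHf i b)).
      by right.
    by left.
  exact: sup_case.
Qed.

Lemma olt_wf : well_founded olt.
Proof.
have acc_lt : forall a b, olt b a -> Acc olt b.
  elim=> [//|a IH|I f IH] b /=; last by case=> i; apply: IH.
  move=> ba; constructor=> c cb; apply: IH.
  exact: ole_trans cb ba.
by move=> a; apply: (acc_lt (osucc a)); apply: ole_refl.
Qed.

(* [idealr_closed] is closure under the operations of a proper ideal. *)
Definition maximal_ideal (R : comNzRingType) (M : set R) : Prop :=
  idealr_closed [in M] /\
  forall J : set R, idealr_closed [in J] -> M `<=` J -> J = M.

Definition principal_ideal (R : comNzRingType) (x : R) : set R :=
  [set r * x | r in [set: R]].

Definition is_pid (R : idomainType) : Prop :=
  forall I : set R, idealr_closed [in I] -> exists x, I = principal_ideal x.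

Definition is_dvr (R : idomainType) : Prop :=
  is_pid R /\
  exists M : set R, [/\ maximal_ideal M, M <> [set 0] &
    forall N : set R, maximal_ideal N -> N = M].

Section Modules.
Variables (R : idomainType) (A : lmodType R).

Definition submodule (B : set A) : Prop := submod_closed [in B].

Definition torsion : Prop := forall a : A, exists2 r : R, r != 0 & r *: a = 0.

Definition countably_generated : Prop :=
  exists S : set A, countable S /\
    forall B : set A, submodule B -> S `<=` B -> B = [set: A].

Definition divisible (D : set A) : Prop :=
  forall r : R, r != 0 -> forall d, D d -> exists2 d', D d' & r *: d' = d.

Definition reduced : Prop :=
  forall D : set A, submodule D -> divisible D -> D = [set 0].

Definition degenerates (a b : A) : Prop :=
  exists phi : {linear A -> A}, phi a = b.

Definition same_orbit (a b : A) : Prop :=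
  exists2 g : {linear A -> A}, bijective g & g a = b.

Variable p : R.

(* At an [osup] it is enough to intersect along the given family; at a limit
   ordinal this is the intersection over all smaller ordinals: [stage_limit]. *)
Fixpoint stage (alpha : Ord) : set A :=
  match alpha with
  | ozero => [set: A]
  | osucc beta => [set p *: x | x in stage beta]
  | osup _ f => \bigcap_i stage (f i)
  end.

Lemma stage_anti alpha beta : ole alpha beta -> stage beta `<=` stage alpha.
Proof.
elim: alpha beta => [//|a IH|I f IH] beta.
- elim: beta => [//|b _|J g IHg] /=.
    by move=> ab _ [x xb <-]; exists x => //; apply: IH xb.
  by case=> i ai x xs; apply: (IHg i ai); apply: xs.
- by move=> h x xb i _; apply: IH xb.
Qed.

Lemma stage_oeq alpha beta : oeq alpha beta -> stage alpha = stage beta.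
Proof. by case=> ab ba; apply/seteqP; split; apply: stage_anti. Qed.

Lemma stage_limit alpha : olimit alpha ->
  forall x, stage alpha x <-> forall beta, olt beta alpha -> stage beta x.
Proof.
move=> [_ limP] x; split=> [xa beta /olt_ole /stage_anti|xs]; first exact.
have: ole alpha alpha by exact: ole_refl.
elim: {1 3}alpha => [//|b _|I f IH] h; first exact: (xs (osucc b) (limP _ h)).
by move=> i _; apply: IH.
Qed.

(* The index types of [osup] live in a universe large enough to contain A, so
   there are enough ordinals for the descending chain to become stationary. *)
Lemma stage_stationary :
  exists lambda, forall alpha, stage lambda `<=` stage alpha.
Proof.
have H (x : A) : exists alpha,
    (exists beta, ~ stage beta x) -> ~ stage alpha x.
  have [[beta h]|h] := pselect (exists beta, ~ stage beta x); first by exists beta.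
  by exists ozero.
exists (osup (fun x : A => projT1 (cid (H x)))) => alpha x xl.
apply: contrapT => xa.
exact: projT2 (cid (H x)) (ex_intro _ alpha xa) (xl x Logic.I).
Qed.

Definition has_height (a : A) (alpha : Ord) : Prop :=
  [/\ a != 0, stage alpha a & ~ stage (osucc alpha) a].

Lemma has_height_uniq a alpha beta :
  has_height a alpha -> has_height a beta -> oeq alpha beta.
Proof.
move=> [_ h1 h2] [_ k1 k2]; split.
  by case: (ole_total alpha beta) => // /stage_anti h; case: k2; apply: h.
by case: (ole_total beta alpha) => // /stage_anti h; case: h2; apply: h.
Qed.

(* [None] is the symbol infinity. The ordinal alpha with [has_height a alpha] is
   unique up to [oeq], and some tree denoting it is chosen. In a reduced module
   such an alpha exists for every nonzero a, so that only 0 is sent to [None]. *)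
Definition height (a : A) : option Ord :=
  if pselect (exists alpha, has_height a alpha) is left h
  then Some (projT1 (cid h)) else None.

Definition ulm_sequence (a : A) (i : nat) : option Ord :=
  height (p ^+ i *: a).

End Modules.

Definition hle (h k : option Ord) : Prop :=
  match h, k with
  | _, None => True
  | None, Some _ => False
  | Some alpha, Some beta => ole alpha beta
  end.

Definition heq (h k : option Ord) : Prop :=
  match h, k with
  | None, None => True
  | Some alpha, Some beta => oeq alpha beta
  | _, _ => False
  end.

Definition dominates (k h : nat -> option Ord) : Prop :=
  forall i, hle (h i) (k i).

Definition coincide (h k : nat -> option Ord) : Prop :=
  forall i, heq (h i) (k i).

(* Main.v *)
Require Import Defs.
From HB Require Import structures.
From mathcomp Require Import all_boot all_order all_algebra.
From mathcomp Require Import boolp classical_sets cardinality.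

Set Implicit Arguments.
Unset Strict Implicit.
Unset Printing Implicit Defensive.

Import GRing.Theory.
Local Open Scope classical_set_scope.
Local Open Scope ring_scope.

(** An endomorphism never lowers heights, and an automorphism preserves them, so
    the conditions on Ulm sequences are necessary. The converses follow Mackey's
    back-and-forth proof of Ulm's theorem. A partial homomorphism is given by its
    graph, a submodule of [A * A] called a correspondence below. In a reduced
    module the stages intersect in zero, so a correspondence that does not lower
    heights is automatically single-valued. The inequalities between the Ulm
    sequences of [a] and [b] say that the correspondence generated by [(a, b)] does
    not lower heights ([monotone_corr_pair]).

    A correspondence of finite length is extended to a new element [x] with [p x]
    in its domain [S]. Submodules of finite length satisfy the descending chain
    condition, so heights attain a maximum on each coset ([max_height]), and [x] may
    be taken of greatest height alpha in [x + S]. To keep heights from dropping, any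
    [y] of height at least alpha with [p y = z], the image of [p x], will do
    ([monotone_adjoin]); such a [y] exists because [z] has height at least
    alpha + 1. To preserve heights, [y] must in turn have the greatest height in its
    coset modulo the range. If [x] is chosen so that the height of [p x] is also
    maximal, this is automatic when [p x] has height alpha + 1. When it is higher,
    [y] is corrected by an element of the socle of [stage alpha], that is, of the
    kernel of [p] in it, not congruent, modulo [stage (alpha + 1)], to an element
    of the range ([exists_proper_image]). Such an element exists because the domain misses one
    and the correspondence identifies the parts of the socle covered by its domain
    and its range ([socle_not_covered]); this replaces the comparison of Ulm
    invariants.

    Extending along a countable set of generators, on both sides in the case of
    automorphisms, and taking the union gives a total correspondence, which is the
    graph of the required endomorphism or automorphism. *)

(** * Submodules and submodules of finite length *)

Section Submodules.
Variables (R : idomainType) (M : lmodType R).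
Implicit Types (B S : set M) (x y : M) (c : R).

Lemma submoduleP B :
  submodule B <-> B 0 /\ forall c x y, B x -> B y -> B (c *: x + y).
Proof.
rewrite /submodule; split=> [[B0 Bl]|[B0 Bl]]; split; rewrite ?inE //.
- by move: B0; rewrite inE.
- by move=> c x y Bx By; have := Bl c x y; rewrite !inE; apply.
- by move=> c x y; rewrite !inE; apply: Bl.
Qed.

Lemma submodule0 B : submodule B -> B 0.
Proof. by case/submoduleP. Qed.

Lemma submoduleZ B c x : submodule B -> B x -> B (c *: x).
Proof. by case/submoduleP=> B0 Bl Bx; rewrite -[_ *: _]addr0; apply: Bl. Qed.

Lemma submoduleD B x y : submodule B -> B x -> B y -> B (x + y).
Proof. by case/submoduleP=> B0 Bl Bx By; rewrite -[x]scale1r; apply: Bl. Qed.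

Lemma submoduleN B x : submodule B -> B x -> B (- x).
Proof. by move=> sB Bx; rewrite -scaleN1r; apply: submoduleZ. Qed.

Lemma submoduleB B x y : submodule B -> B x -> B y -> B (x - y).
Proof. by move=> sB Bx By; apply: submoduleD => //; apply: submoduleN. Qed.

Lemma submodule_set0 : submodule [set 0 : M].
Proof. by apply/submoduleP; split=> // c x y -> ->; rewrite scaler0 addr0. Qed.

Lemma submoduleI B S : submodule B -> submodule S -> submodule (B `&` S).
Proof.
move=> /submoduleP[B0 Bl] /submoduleP[S0 Sl]; apply/submoduleP; split=> //.
by move=> c x y [? ?] [? ?]; split; [apply: Bl|apply: Sl].
Qed.

Lemma submodule_sum B S : submodule B -> submodule S ->
  submodule [set z | exists2 b, B b & S (z - b)].
Proof.
move=> /submoduleP[B0 Bl] /submoduleP[S0 Sl]; apply/submoduleP; split.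
  by exists 0 => //; rewrite subr0.
move=> c x y [b Bb Sb] [b' Bb' Sb']; exists (c *: b + b'); first exact: Bl.
have -> : c *: x + y - (c *: b + b') = c *: (x - b) + (y - b').
  by rewrite scalerBr opprD addrACA.
exact: Sl.
Qed.

(** The submodule [S + R x]. *)
Definition adjoin S x : set M := [set z | exists c, S (z - c *: x)].

Lemma submodule_adjoin S x : submodule S -> submodule (adjoin S x).
Proof.
case/submoduleP=> S0 Sl; apply/submoduleP; split.
  by exists 0; rewrite scale0r subr0.
move=> c z z' [d Sd] [d' Sd']; exists (c * d + d').
have -> : c *: z + z' - (c * d + d') *: x
          = c *: (z - d *: x) + (z' - d' *: x).
  by rewrite scalerBr scalerA scalerDl opprD addrACA.
exact: Sl.
Qed.

Lemma adjoin_sub S x : S `<=` adjoin S x.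
Proof. by move=> s Ss; exists 0; rewrite scale0r subr0. Qed.

Lemma adjoin_mem S x : submodule S -> adjoin S x x.
Proof. by move=> sS; exists 1; rewrite scale1r subrr; apply: submodule0. Qed.

Lemma adjoin_min S x B : submodule B -> S `<=` B -> B x -> adjoin S x `<=` B.
Proof.
move=> sB SB Bx z [c /SB Bz]; rewrite -[z](subrK (c *: x)).
by apply: submoduleD => //; apply: submoduleZ.
Qed.

End Submodules.

(** A submodule has finite length when it is obtained from [0] by finitely many
    extensions [S + R x] with [p x] in [S], that is, by finitely many extensions
    that are zero or simple. *)
Inductive finite_length (R : idomainType) (p : R) (M : lmodType R) :
  set M -> Prop :=
| finite_length0 : finite_length p [set 0]
| finite_length_adjoin S x :
    finite_length p S -> S (p *: x) -> finite_length p (adjoin S x).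

Section FiniteLength.
Variables (R : idomainType) (p : R) (M : lmodType R).
Implicit Types (B S K : set M) (x y : M) (c : R).

Lemma finite_length_submodule S : finite_length p S -> submodule S.
Proof.
elim=> [|T x _ sT _]; first exact: submodule_set0.
exact: submodule_adjoin.
Qed.

Lemma finite_length_adjoinX S x n :
  finite_length p S -> S (p ^+ n *: x) -> finite_length p (adjoin S x).
Proof.
move=> fS; have sS := finite_length_submodule fS.
elim: n x => [|n IH] x.
  rewrite expr0 scale1r => Sx; suff -> : adjoin S x = S by [].
  by apply/seteqP; split; [apply: adjoin_min|apply: adjoin_sub].
rewrite exprSr -scalerA => /IH fT.
have sT := finite_length_submodule fT.
have -> : adjoin S x = adjoin (adjoin S (p *: x)) x.
  apply/seteqP; split; apply: adjoin_min.
  - exact: submodule_adjoin.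
  - by apply: subset_trans (@adjoin_sub _ _ _ _); apply: adjoin_sub.
  - exact: adjoin_mem.
  - exact: submodule_adjoin.
  - apply: adjoin_min; [exact: submodule_adjoin|exact: adjoin_sub|].
    by apply: submoduleZ; [exact: submodule_adjoin|exact: adjoin_mem].
  - exact: adjoin_mem.
by apply: finite_length_adjoin => //; apply: adjoin_mem.
Qed.

Lemma finite_length_image (N : lmodType R) (f : {linear M -> N}) S :
  finite_length p S -> finite_length p (f @` S).
Proof.
elim=> [|T x fT IH Tpx].
  by rewrite image_set1 linear0; apply: finite_length0.
suff -> : f @` adjoin T x = adjoin (f @` T) (f x).
  by apply: finite_length_adjoin => //; exists (p *: x) => //; rewrite linearZ.
apply/seteqP; split=> [_ [z [c Tz] <-]|z [c [t Tt ftE]]].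
  by exists c, (z - c *: x) => //; rewrite linearB linearZ.
exists (t + c *: x); first by exists c; rewrite addrK.
by rewrite linearD linearZ /= ftE subrK.
Qed.

Hypothesis p_local : forall c, ~ principal_ideal p c -> c \is a GRing.unit.

(** The descending chain condition for submodules of [S + K] modulo [K], where
    [S] has finite length, provided that the traces of the chain on [K] are
    stationary. *)
Lemma finite_length_dcc S K (V : nat -> set M) :
    finite_length p S -> submodule K -> (forall n, submodule (V n)) ->
    (forall n, V n.+1 `<=` V n) ->
    (forall n z, V n z -> exists2 s, S s & K (z - s)) ->
    (exists N, forall n, (N <= n)%N -> V N `&` K `<=` V n) ->
  exists N, forall n, (N <= n)%N -> V N `<=` V n.
Proof.
move=> fS sK; elim: fS V => [|T x fT IH Tpx] V sV dV VS [N0 KN].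
  exists N0 => n leNn z Vz; apply: KN => //; split=> //.
  by have [_ -> ] := VS _ _ Vz; rewrite subr0.
have sT := finite_length_submodule fT.
pose TK := [set z | exists2 t, T t & K (z - t)].
have sTK : submodule TK by apply: submodule_sum.
have antiV m n : (m <= n)%N -> V n `<=` V m.
  move=> /subnKC <-; elim: (n - m)%N => [|k IHk]; first by rewrite addn0.
  by rewrite addnS => z /dV/IHk.
have [||||N Nst] := IH (fun n => V n `&` TK).
- by move=> n; apply: submoduleI.
- by move=> n z [/dV Vz TKz]; split.
- by move=> n z [].
- exists N0 => n leNn z [[Vz TKz] Kz]; split=> //; exact: (KN n leNn).
have [[m Vm]|noV] := pselect (exists m, V m `<=` TK).
  exists (maxn m N) => n; rewrite geq_max => /andP[mn Nn] z Vz.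
  have Vmz : V m z by apply: antiV Vz; apply: leq_maxl.
  have [] // := Nst n Nn z; split; last exact: Vm.
  by apply: antiV Vz; apply: leq_maxr.
exists N => n Nn z Vz.
have [v Vv TKv] : exists2 v, V n v & ~ TK v.
  apply: contrapT => h; apply: noV; exists n => v Vv.
  by apply: contrapT => TKv; apply: h; exists v.
(* T + R x + K is simple modulo T + K, hence generated by v *)
have [s [d Td] Ks] := VS _ _ Vv; have [s' [c Tc] Ks'] := VS _ _ Vz.
have Ud : d \is a GRing.unit.
  apply: p_local => -[e _ eE]; apply: TKv; exists s => //.
  rewrite -[s](subrK (d *: x)); apply: submoduleD => //.
  by rewrite -eE -scalerA; apply: submoduleZ.
have TKzv : TK (z - (c / d) *: v).
  exists (s' - (c / d) *: s).
    have -> : s' - (c / d) *: s = (s' - c *: x) - (c / d) *: (s - d *: x).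
      by rewrite scalerBr scalerA divrK // opprB addrA subrK.
    by apply: submoduleB => //; apply: submoduleZ.
  have -> : z - (c / d) *: v - (s' - (c / d) *: s)
            = (z - s') - (c / d) *: (v - s).
    by rewrite scalerBr !opprB addrACA [RHS]addrACA (addrC (- _) (- _)).
  by apply: submoduleB => //; apply: submoduleZ.
rewrite -[z](subrK ((c / d) *: v)); apply: submoduleD => //.
  have [|//] := Nst n Nn (z - (c / d) *: v); split=> //.
  by apply: submoduleB => //; apply: submoduleZ => //; apply: antiV Vv.
exact: submoduleZ.
Qed.

End FiniteLength.

(** * Heights *)

Section Heights.
Variables (R : idomainType) (p : R) (A : lmodType R).
Implicit Types (x y : A) (c : R) (alpha beta : Ord).

Lemma stage_submodule alpha : submodule (stage p alpha : set A).
Proof.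
elim: alpha => [|alpha /submoduleP[s0 sl]|I f IH]; apply/submoduleP.
- by split.
- split; first by exists 0; rewrite ?scaler0.
  move=> c _ _ [x sx <-] [y sy <-]; exists (c *: x + y); first exact: sl.
  by rewrite scalerDr !scalerA mulrC.
- split=> [i _|c x y sx sy i _]; first exact: submodule0 (IH i).
  have [_ sl] := (submoduleP (stage p (f i) : set A)).1 (IH i).
  by apply: sl; [apply: sx|apply: sy].
Qed.

Lemma stage0 alpha : stage p alpha (0 : A).
Proof. exact: submodule0 (stage_submodule alpha). Qed.

Lemma stageD alpha x y :
  stage p alpha x -> stage p alpha y -> stage p alpha (x + y).
Proof. by move=> *; apply: submoduleD => //; apply: stage_submodule. Qed.

Lemma stageB alpha x y :
  stage p alpha x -> stage p alpha y -> stage p alpha (x - y).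
Proof. by move=> *; apply: submoduleB => //; apply: stage_submodule. Qed.

Lemma stageZ alpha c x : stage p alpha x -> stage p alpha (c *: x).
Proof. by move=> *; apply: submoduleZ => //; apply: stage_submodule. Qed.

Lemma stage_unit alpha c x :
  c \is a GRing.unit -> stage p alpha (c *: x) -> stage p alpha x.
Proof. by move=> Uc /(stageZ c^-1); rewrite scalerA mulVr // scale1r. Qed.

Lemma stage_succ alpha x : stage p (osucc alpha) x -> stage p alpha x.
Proof. by apply: stage_anti; apply/ole_osucc/ole_refl. Qed.

Lemma stage_linear (N : lmodType R) (f : {linear A -> N}) alpha x :
  stage p alpha x -> stage p alpha (f x).
Proof.
elim: alpha x => [//|alpha IH|I g IH] x /=.
  by case=> y /IH sy <-; exists (f y) => //; rewrite linearZ.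
by move=> sx i _; apply/IH/sx.
Qed.

(** The height of [x] is at most that of [y]. *)
Definition height_le x y := forall alpha, stage p alpha x -> stage p alpha y.

Lemma height_le_total x y : height_le x y \/ height_le y x.
Proof.
have [|/existsNP[alpha /not_implyP[sx nsy]]] := pselect (height_le x y).
  by left.
right=> beta sy; case: (ole_total beta alpha) => [/stage_anti|/olt_ole ab].
  exact.
by case: nsy; apply: stage_anti sy.
Qed.

Lemma height_leNsucc alpha x y :
  ~ stage p (osucc alpha) x -> stage p alpha y -> height_le x y.
Proof.
move=> nsx sy beta sx; case: (ole_total beta alpha) => [/stage_anti|ab].
  exact.
by case: nsx; apply: stage_anti sx.
Qed.

Hypothesis p_local : forall c, ~ principal_ideal p c -> c \is a GRing.unit.

(** Heights satisfy the ascending chain condition on a submodule of finite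
    length: a strictly increasing sequence of heights would make the submodules
    of the elements at least as high strictly decrease. *)
Lemma max_height (S X : set A) x0 :
    finite_length p S -> X `<=` S -> X x0 ->
  exists2 x, X x & forall y, X y -> height_le y x.
Proof.
move=> fS XS Xx0; apply: contrapT => noX.
have next x : exists y, X x -> X y /\ ~ height_le y x.
  have [Xx|nXx] := pselect (X x); last by exists 0.
  apply: contrapT => h; apply: noX; exists x => // y Xy.
  by apply: contrapT => nyx; apply: h; exists y.
pose f x := projT1 (cid (next x)).
have fP x : X x -> X (f x) /\ ~ height_le (f x) x := projT2 (cid (next x)).
pose u n := iter n f x0.
have Xu n : X (u n) by elim: n => // n /fP[].
have leu n : height_le (u n) (u n.+1).
  case: (height_le_total (u n) (u n.+1)) => //.
  by have [_] := fP _ (Xu n).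
pose V n := [set s | S s /\ height_le (u n) s].
have sS := finite_length_submodule fS.
have [|||||N Nst] := @finite_length_dcc _ p A p_local S [set 0] V fS.
- exact: submodule_set0.
- move=> n; apply/submoduleP; split.
    split; first exact: submodule0.
    by move=> alpha _; exact: stage0.
  move=> c x y [Sx hx] [Sy hy]; split.
    by apply: submoduleD => //; apply: submoduleZ.
  by move=> alpha su; apply: stageD; [apply/stageZ/hx|apply: hy].
- by move=> n s [Ss hs]; split=> // alpha /leu; apply: hs.
- by move=> n z [Sz _]; exists z => //; rewrite /= subrr.
- exists 0%N => n _ _ [_ ->]; split; first exact: submodule0.
  by move=> alpha _; exact: stage0.
have [|_] := Nst N.+1 (leqnSn N) (u N); first by split; [apply: XS|].
by have [_] := fP _ (Xu N).
Qed.

Hypothesis p_factor : forall r : R, r != 0 ->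
  exists2 c, c \is a GRing.unit & exists n, r = c * p ^+ n.
Hypothesis A_reduced : reduced A.

(** The intersection of all stages is divisible, hence zero in a reduced module. *)
Lemma stage_sep x : (forall alpha, stage p alpha x) -> x = 0.
Proof.
move=> sx; pose D := [set y : A | forall alpha, stage p alpha y].
have sD : submodule D.
  apply/submoduleP; split=> [alpha|c y z Dy Dz alpha].
    exact: stage0.
  by apply: stageD; [apply: stageZ|]; [apply: Dy|apply: Dz].
have [lam lamP] := stage_stationary A p.
have divp n d : D d -> exists2 d', D d' & p ^+ n *: d' = d.
  elim: n d => [|n IH] d Dd; first by exists d; rewrite ?expr0 ?scale1r.
  have [d1 Dd1 d1E] := IH _ Dd.
  have [d2 sd2 d2E] := Dd1 (osucc lam).
  exists d2; first by move=> alpha; apply: lamP.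
  by rewrite exprSr -scalerA d2E.
suff DE : D = [set 0] by have : D x := sx; rewrite DE.
apply: A_reduced => // r /p_factor[c Uc [n ->]] d Dd.
have [d' Dd' d'E] := divp n _ Dd.
exists (c^-1 *: d'); first by apply: (submoduleZ _ sD).
by rewrite scalerA mulrAC divrr // mul1r.
Qed.

Lemma exists_height x : x <> 0 ->
  exists2 alpha, stage p alpha x & ~ stage p (osucc alpha) x.
Proof.
move=> x0; have [beta nsx] : exists beta, ~ stage p beta x.
  by apply/existsNP => /stage_sep.
elim: beta nsx => [[]//|beta IH|I f IH] nsx.
  by have [sx|/IH] := pselect (stage p beta x); first exists beta.
by have /existsNP[i /not_implyP[_ /IH]] := nsx.
Qed.

Lemma has_heightP x : x <> 0 -> exists alpha, has_height p x alpha.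
Proof.
by move=> x0; have [alpha] := exists_height x0; exists alpha; split=> //;
  apply/eqP.
Qed.

Lemma heightP x : if height p x is Some alpha then has_height p x alpha
                  else x = 0.
Proof.
rewrite /height; case: pselect => [h|h]; first exact: projT2 (cid h).
by apply: contrapT => /has_heightP.
Qed.

Lemma has_height_le x y alpha beta :
  has_height p x alpha -> has_height p y beta ->
  ole alpha beta <-> height_le x y.
Proof.
move=> [_ sx nsx] [_ sy nsy]; split=> [ab|/(_ _ sx) sxy].
  apply: height_leNsucc nsx _; exact: stage_anti sy.
by case: (ole_total alpha beta) => // /stage_anti ba; case: nsy; apply: ba.
Qed.

Lemma hle_heightP x y : hle (height p x) (height p y) <-> height_le x y.
Proof.
move: (heightP x) (heightP y).
case: (height p x) => [alpha|] hx; case: (height p y) => [beta|] hy /=.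
- exact: has_height_le.
- by split=> // _ gamma _; rewrite hy; exact: stage0.
- split=> // xy; case: hy => /eqP[]; apply: stage_sep => gamma.
  by apply: xy; rewrite hx; exact: stage0.
- by split=> // _; rewrite hx hy.
Qed.

Lemma heq_heightP x y :
  heq (height p x) (height p y) <-> height_le x y /\ height_le y x.
Proof.
rewrite -!hle_heightP.
by case: (height p x) => [alpha|]; case: (height p y) => [beta|] /=;
  rewrite /oeq; tauto.
Qed.

End Heights.

(** * Correspondences *)

(** A correspondence is a submodule of [A * A], viewed as the graph of a partial
    homomorphism; [converse] exchanges its two sides. *)
Definition converse (T : Type) (G : set (T * T)) : set (T * T) :=
  [set z | G (z.2, z.1)].

Section Correspondences.
Variables (R : idomainType) (p : R) (A : lmodType R).
Implicit Types (x y s t : A) (c : R) (alpha beta : Ord) (G : set (A * A)).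

Lemma corr_lin G c x y s t :
  submodule G -> G (x, y) -> G (s, t) -> G (c *: x + s, c *: y + t).
Proof.
by move=> sG xy st; exact: (submoduleD sG (submoduleZ c sG xy) st).
Qed.

Lemma submodule_converse G : submodule G -> submodule (converse G).
Proof.
move=> /submoduleP[G0 Gl]; apply/submoduleP; split; first exact: G0.
by move=> c x y Gx Gy; exact: (Gl c _ _ Gx Gy).
Qed.

Lemma converse_adjoin G x y :
  converse (adjoin G (x, y)) = adjoin (converse G) (y, x).
Proof. by []. Qed.

Lemma finite_length_converse G :
  finite_length p G -> finite_length p (converse G).
Proof.
elim=> [|H [x y] _ fH Hxy].
  suff -> : converse [set 0 : A * A] = [set 0] by apply: finite_length0.
  by apply/seteqP; split=> -[a b] [-> ->].
by rewrite converse_adjoin; apply: finite_length_adjoin.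
Qed.

Lemma finite_length_domain G : finite_length p G ->
  finite_length p [set x | exists y, G (x, y)].
Proof.
move=> fG; suff -> : [set x | exists y, G (x, y)] = fst @` G.
  exact: (finite_length_image (@fst A A) fG).
by apply/seteqP; split=> [x [y Gxy]|_ [[x y] Gxy <-]]; [exists (x, y)|exists y].
Qed.

(** A monotone correspondence never lowers heights. *)
Definition monotone G := forall x y, G (x, y) -> height_le p x y.

Hypothesis p_local : forall c, ~ principal_ideal p c -> c \is a GRing.unit.

(** If [x] has the greatest height in its coset modulo the domain, then sending
    [x] to an element at least as high keeps a correspondence monotone, because
    [x + s] has the smaller of the heights of [x] and [s]. *)
Lemma monotone_adjoin G alpha x y :
    submodule G -> monotone G -> G (p *: x, p *: y) ->
    stage p alpha x -> stage p alpha y ->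
    (forall s t, G (s, t) -> ~ stage p (osucc alpha) (x + s)) ->
  monotone (adjoin G (x, y)).
Proof.
move=> sG mG Gp sx sy xmax z w [c Gzw].
have {}Gzw : G (z - c *: x, w - c *: y) := Gzw.
have [[d _ dE]|/p_local Uc] := pselect (principal_ideal p c).
  apply: mG; have := corr_lin d sG Gp Gzw.
  by rewrite !scalerA dE ![c *: _ + _]addrC !subrK.
move=> beta sz.
have ba : ole beta alpha.
  case: (ole_total beta alpha) => // /stage_anti ab; case: (@xmax
    (c^-1 *: (z - c *: x)) (c^-1 *: (w - c *: y))).
    by have := submoduleZ c^-1 sG Gzw.
  rewrite scalerBr scalerA mulVr // scale1r addrC subrK.
  by apply/stageZ/ab.
have {}sx := stage_anti ba sx; have {}sy := stage_anti ba sy.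
rewrite -[w](subrK (c *: y)); apply: stageD; last exact: stageZ.
by apply: (mG _ _ Gzw); apply: stageB => //; apply: stageZ.
Qed.

(** For a height-preserving correspondence of finite length, if the domain does
    not cover the socle of [stage alpha] modulo [stage (osucc alpha)], then neither
    does the range. If the range covers it, the correspondence
    induces an injective endomorphism of the socle, whose iterated images form a
    stationary chain; so it is onto, and the domain covers the socle too. *)
Lemma socle_not_covered G alpha w0 :
    finite_length p G -> monotone G -> monotone (converse G) ->
    stage p alpha w0 -> p *: w0 = 0 ->
    (forall s t, G (s, t) -> ~ stage p (osucc alpha) (w0 - s)) ->
  exists w, [/\ stage p alpha w, p *: w = 0 &
    forall s t, G (s, t) -> ~ stage p (osucc alpha) (w + t)].
Proof.
move=> fG mG mcG sw0 pw0 w0max; apply: contrapT => nocov.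
have sG := finite_length_submodule fG.
pose K : set A := stage p (osucc alpha).
have sK : submodule K by apply: stage_submodule.
pose W := [set w : A | stage p alpha w /\ p *: w = 0].
have sW : submodule W.
  apply/submoduleP; split=> [|c x y [sx px] [sy py]].
    by split; [apply: stage0|rewrite scaler0].
  split; first by apply: stageD => //; apply: stageZ.
  by rewrite scalerDr py scalerA mulrC -scalerA px scaler0 addr0.
have cov w : W w -> exists s t, G (s, t) /\ K (t - w).
  move=> [sw pw]; apply: contrapT => ncov; apply: nocov.
  exists w; split=> // s t Gst Kwt; apply: ncov; exists (- s), (- t).
  split; first exact: (submoduleN sG Gst).
  by rewrite -opprD addrC; apply: submoduleN.
(* the relation induced on the socle by the inverse correspondence *)
pose theta w w' := exists s t, [/\ G (s, t), K (t - w) & K (s - w')].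
have thetaD c x x' y y' :
    theta x x' -> theta y y' -> theta (c *: x + y) (c *: x' + y').
  have linK u v u' v' : K (u - v) -> K (u' - v') ->
      K ((c *: u + u') - (c *: v + v')).
    by rewrite opprD addrACA -scalerBr => ? ?; apply: submoduleD => //;
      apply: submoduleZ.
  move=> [s [t [Gst Kt Ks]]] [s' [t' [Gst' Kt' Ks']]].
  by exists (c *: s + s'), (c *: t + t'); split;
    [apply: corr_lin|apply: linK|apply: linK].
have theta_inj w : theta w 0 -> K w.
  move=> [s [t [Gst Kt]]]; rewrite subr0 => /(mG _ _ Gst) Kt'.
  by rewrite -[w](subKr t); apply: submoduleB.
have theta_total w : W w -> exists2 w', W w' & theta w w'.
  move=> [sw pw]; have [s [t [Gst Kt]]] := cov w (conj sw pw).
  have st : stage p alpha t.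
    by rewrite -[t](subrK w); apply: stageD => //; apply: stage_succ.
  (* p t = p (t - w) has height at least alpha + 2, hence so does p s *)
  have [v Kv vE] : stage p (osucc (osucc alpha)) (p *: s).
    apply: (mcG (p *: t) (p *: s)); first exact: (submoduleZ p sG Gst).
    by exists (t - w) => //; rewrite scalerBr pw subr0.
  exists (s - v); last by exists s, t; split; rewrite ?subKr.
  split; last by rewrite scalerBr vE subrr.
  by apply: stageB; [apply: (mcG _ _ Gst)|apply: stage_succ].
pose fix V n : set A := if n is m.+1
  then [set w' | W w' /\ exists2 w, V m w & theta w w'] else W.
have sV n : submodule (V n).
  elim: n => [//|n /submoduleP[V0 Vl]]; apply/submoduleP; split.
    split; first exact: submodule0.
    exists 0 => //; exists 0, 0; split; rewrite ?subrr;
      [exact: (submodule0 sG)|exact: stage0|exact: stage0].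
  move=> c x y [Wx [u Vu ux]] [Wy [v Vv vy]]; split.
    by apply: submoduleD => //; apply: submoduleZ.
  by exists (c *: u + v); [apply: Vl|apply: thetaD].
have VW n : V n `<=` W by case: n => [//|n] w [].
have dV n : V n.+1 `<=` V n.
  elim: n => [|n IH] w [Ww [u Vu uw]] //.
  by split=> //; exists u => //; apply: IH.
have KV n w w' : V n w -> W w' -> K (w - w') -> V n w'.
  case: n => [//|n] [Ww [u Vu [s [t [Gst Kt Ks]]]]] Ww' Kww'; split=> //.
  exists u => //; exists s, t; split=> //.
  by rewrite -(subrK w s) -addrA; apply: submoduleD.
have [|n w Vw||N Nst] := @finite_length_dcc _ p A p_local
  [set t | exists s, G (s, t)] K V _ sK sV dV.
- exact: (finite_length_domain (finite_length_converse fG)).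
- have [s [t [Gst Kt]]] := cov w (VW n _ Vw).
  by exists t; [exists s|rewrite -opprB; apply: submoduleN].
- exists 0%N => n _ w [Ww Kw]; apply: (@KV n 0) => //.
    exact: submodule0.
  by rewrite sub0r; apply: submoduleN.
have step n : V n.+1 `<=` V n.+2 -> V n `<=` V n.+1.
  move=> le u Vu; have [u' Wu' uu'] := theta_total u (VW n _ Vu).
  have [|_ [v Vv vu']] := le u'; first by split=> //; exists u.
  apply: (KV _ v) => //; first exact: VW Vu.
  apply: theta_inj; have := thetaD (-1) _ _ _ _ uu' vu'.
  by rewrite !scaleN1r addNr addrC.
have V01 : V 0%N `<=` V 1%N.
  have := Nst N.+1 (leqnSn N); elim: N {Nst} => [//|N IH] /step; exact: IH.
have [|_ [w _ [s [t [Gst _ Ks]]]]] := V01 w0; first by split.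
by apply: (w0max s t) => //; rewrite -opprB; apply: submoduleN.
Qed.

(** The image of [x] under a one-step extension of a height-preserving
    correspondence. Either [p x] has height exactly [alpha + 1], and every
    preimage of [z] in [stage alpha] will do, by the maximality of [p x]; or [p x]
    is higher, and a preimage of [z] in [stage (alpha + 1)] is corrected by an
    element of the socle. *)
Lemma exists_proper_image G alpha x z :
    finite_length p G -> monotone G -> monotone (converse G) ->
    stage p alpha x -> G (p *: x, z) ->
    (forall s t, G (s, t) -> ~ stage p (osucc alpha) (x + s)) ->
    (forall s t, G (s, t) -> stage p alpha (x + s) ->
       height_le p (p *: (x + s)) (p *: x)) ->
  exists y, [/\ p *: y = z, stage p alpha y &
    forall s t, G (s, t) -> ~ stage p (osucc alpha) (y + t)].
Proof.
move=> fG mG mcG sx Gz xprop pxmax.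
have sG := finite_length_submodule fG.
have [[v sv vE]|nspx] := pselect (stage p (osucc (osucc alpha)) (p *: x)).
  have [|||w [sw pw wprop]] := @socle_not_covered G alpha (x - v) fG mG mcG.
  - by apply: stageB => //; apply: stage_succ.
  - by rewrite scalerBr vE subrr.
  - move=> s t Gst h; apply: (@xprop (- s) (- t)).
      exact: (submoduleN sG Gst).
    by have := stageD h sv; rewrite addrAC subrK.
  have [|y sy yE] := mG _ _ Gz (osucc (osucc alpha)); first by exists v.
  exists (y + w); split; first by rewrite scalerDr pw addr0.
    by apply: stageD => //; apply: stage_succ.
  move=> s t Gst h; apply: (wprop s t) => //.
  by have := stageB h sy; rewrite -(addrA y) [y + _]addrC addrK.
have [|y sy yE] := mG _ _ Gz (osucc alpha); first by exists x.
exists y; split=> // s t Gst h.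
have Gpst : G (p *: (x + s), p *: (y + t)).
  rewrite [p *: (x + s)]scalerDr [p *: (y + t)]scalerDr yE.
  by rewrite addrC [z + _]addrC; apply: corr_lin.
have ss : stage p alpha s.
  apply: (mcG t s Gst); rewrite -[t](addKr y) addrC.
  by apply: stageB => //; apply: stage_succ.
apply: nspx; apply: (pxmax s t Gst); first exact: stageD.
by apply: (mcG _ _ Gpst); exists (y + t).
Qed.

Hypothesis p_factor : forall r : R, r != 0 ->
  exists2 c, c \is a GRing.unit & exists n, r = c * p ^+ n.
Hypothesis A_reduced : reduced A.

(** A representative of a nonzero coset that has the greatest height in it and,
    among those, the greatest height after multiplication by [p]. *)
Lemma exists_proper (S : set A) x :
    finite_length p S -> ~ S x -> S (p *: x) ->
  exists2 x', S (x' - x) & exists2 alpha, stage p alpha x' &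
    (forall s, S s -> ~ stage p (osucc alpha) (x' + s)) /\
    (forall s, S s -> stage p alpha (x' + s) ->
       height_le p (p *: (x' + s)) (p *: x')).
Proof.
move=> fS nSx Spx; have sS := finite_length_submodule fS.
have fSx := finite_length_adjoin fS Spx.
have [||x1 Sx1 x1max] := @max_height _ p A p_local _ [set y | S (y - x)] x fSx.
- by move=> y Sy; exists 1; rewrite scale1r.
- by rewrite /= subrr; apply: submodule0.
pose X := [set y | S (y - x) /\ height_le p x1 y].
have [||_ [x' [Sx' hx'] <-] x'max] :=
  @max_height _ p A p_local S [set p *: y | y in X] (p *: x1) fS.
- move=> _ [y [Sy _] <-]; rewrite -[y](subrK x) scalerDr.
  by apply: submoduleD => //; apply: submoduleZ.
- by exists x1 => //; split=> // beta.
have x'0 : x' <> 0.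
  by move=> x'0; have := submoduleN sS Sx'; rewrite x'0 sub0r opprK.
have [alpha sx' nsx'] := exists_height p_factor A_reduced x'0.
have coset s : S s -> S (x' + s - x).
  by move=> Ss; rewrite addrAC; apply: submoduleD.
exists x' => //; exists alpha => //; split=> s Ss.
  by move=> /(x1max _ (coset s Ss))/hx'.
move=> sxs; apply: x'max; exists (x' + s) => //; split; first exact: coset.
by move=> beta /hx'; apply: (height_leNsucc nsx' sxs).
Qed.

Hypothesis A_torsion : forall x, exists n, p ^+ n *: x = 0.

(** It suffices to extend to [x] when [p x] is in the domain, since a power of [p]
    kills [x]. *)
Lemma extend_domain (P : set (A * A) -> Prop) :
    (forall G, P G -> submodule G) ->
    (forall G x, P G -> (exists z, G (p *: x, z)) ->
       exists G', [/\ P G', G `<=` G' & exists y, G' (x, y)]) ->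
  forall G x, P G -> exists G', [/\ P G', G `<=` G' & exists y, G' (x, y)].
Proof.
move=> Psub Pstep G x PG; have [n] := A_torsion x.
elim: n x => [|n IH] x.
  rewrite expr0 scale1r => ->; exists G; split=> //; exists 0.
  exact: (submodule0 (Psub G PG)).
rewrite exprSr -scalerA => /IH[G1 [PG1 GG1 /(Pstep _ _ PG1)[G2 [PG2 G12 G2x]]]].
by exists G2; split=> //; apply: subset_trans G12.
Qed.

(** The partial homomorphisms of finite length that do not lower heights. *)
Definition monotone_corr G := finite_length p G /\ monotone G.

(** The height-preserving isomorphisms between submodules of finite length. *)
Definition height_preserving_corr G :=
  [/\ finite_length p G, monotone G & monotone (converse G)].

Lemma height_preserving_converse G :
  height_preserving_corr G -> height_preserving_corr (converse G).
Proof.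
move=> [fG mG mcG]; split=> //; exact: finite_length_converse.
Qed.

(** To extend a correspondence to [x], with [p x] in the domain, it suffices to
    extend it to a representative [x'] of the coset of [x] chosen as in
    [exists_proper]. *)
Lemma extend_step (P : set (A * A) -> Prop) G x :
    finite_length p G -> P G -> (exists z, G (p *: x, z)) ->
    (forall x' z alpha, stage p alpha x' -> G (p *: x', z) ->
       (forall s t, G (s, t) -> ~ stage p (osucc alpha) (x' + s)) ->
       (forall s t, G (s, t) -> stage p alpha (x' + s) ->
          height_le p (p *: (x' + s)) (p *: x')) ->
       exists2 y, p *: y = z & P (adjoin G (x', y))) ->
  exists G', [/\ P G', G `<=` G' & exists y, G' (x, y)].
Proof.
move=> fG PG [z Gz] ext; have sG := finite_length_submodule fG.
have [Gx|nGx] := pselect (exists y, G (x, y)); first by exists G; split.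
have [x' [t Gx't] [alpha sx' [xprop pxmax]]] :=
  exists_proper (finite_length_domain fG) nGx (ex_intro _ z Gz).
have Gpx' : G (p *: x', p *: t + z).
  by have := corr_lin p sG Gx't Gz; rewrite scalerBr subrK.
have [||y yE PG'] := ext x' _ alpha sx' Gpx'.
- by move=> s u Gsu; apply: xprop; exists u.
- by move=> s u Gsu; apply: pxmax; exists u.
exists (adjoin G (x', y)); split=> //; first exact: adjoin_sub.
have sG' : submodule (adjoin G (x', y)) by apply: submodule_adjoin.
exists (y - t).
have := submoduleB sG' (adjoin_mem (x', y) sG) (adjoin_sub (x', y) Gx't).
suff -> : (x', y) - (x' - x, t) = (x, y - t) by [].
by congr pair => /=; rewrite subKr.
Qed.

Lemma monotone_extend G x : monotone_corr G ->
  exists G', [/\ monotone_corr G', G `<=` G' & exists y, G' (x, y)].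
Proof.
move=> hG; apply: (extend_domain (P := monotone_corr)) hG.
  by move=> H [fH _]; apply: finite_length_submodule fH.
move=> {G x} G x [fG mG] Gpx.
apply: (extend_step (P := monotone_corr) fG _ Gpx) => //
  x' z alpha sx' Gz xprop _.
have [|y sy yE] := mG _ _ Gz (osucc alpha); first by exists x'.
exists y => //; split.
  by apply: finite_length_adjoin => //; rewrite -yE in Gz.
apply: monotone_adjoin sx' sy xprop => //; last by rewrite yE.
exact: finite_length_submodule fG.
Qed.

Lemma height_preserving_extend_domain G x : height_preserving_corr G ->
  exists G', [/\ height_preserving_corr G', G `<=` G' & exists y, G' (x, y)].
Proof.
move=> hG; apply: (extend_domain (P := height_preserving_corr)) hG.
  by move=> H [fH _ _]; apply: finite_length_submodule fH.
move=> {G x} G x [fG mG mcG] Gpx.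
apply: (extend_step (P := height_preserving_corr) fG _ Gpx) => //
  x' z alpha sx' Gz xprop pxmax.
have sG := finite_length_submodule fG.
have [y [yE sy yprop]] := exists_proper_image fG mG mcG sx' Gz xprop pxmax.
rewrite -yE in Gz; exists y => //; split.
- exact: finite_length_adjoin.
- exact: monotone_adjoin sx' sy xprop.
- rewrite converse_adjoin; apply: monotone_adjoin sy sx' _ => //.
    exact: submodule_converse.
  by move=> t s; apply: yprop.
Qed.

Lemma height_preserving_extend G x : height_preserving_corr G ->
  exists G', [/\ height_preserving_corr G', G `<=` G',
    exists y, G' (x, y) & exists y, G' (y, x)].
Proof.
move=> /(height_preserving_extend_domain x)[G1 [hG1 GG1 G1x]].
move/height_preserving_converse: hG1 => hG1.
have [G2 [hG2 G12 G2x]] := height_preserving_extend_domain x hG1.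
exists (converse G2); split=> //; first exact: height_preserving_converse.
  by move=> [u v] /GG1 G1uv; apply: G12.
by have [y G1xy] := G1x; exists y; apply: G12.
Qed.

End Correspondences.

(** * Unions of chains of correspondences *)

Section Limits.
Variables (R : idomainType) (p : R) (A : lmodType R).
Implicit Types (x y : A) (G : set (A * A)).

(** The union of a chain of correspondences satisfying [P], built so as to meet the
    requirements [Q x] for all [x] in a countable set. *)
Lemma chain_union (P : set (A * A) -> Prop) (Q : A -> set (A * A) -> Prop)
    (S : set A) (G : set (A * A)) :
    countable S -> (forall H, P H -> submodule H) ->
    (forall x H H', Q x H -> H `<=` H' -> Q x H') ->
    (forall H x, P H -> exists H', [/\ P H', H `<=` H' & Q x H']) ->
    P G ->
  exists U : set (A * A), [/\ submodule U, G `<=` U,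
    forall z, U z -> exists2 H, P H & H z & forall x, S x -> Q x U].
Proof.
move=> /countable_injP[rk rk_inj] Psub Qup ext PG.
pose g n := xget 0 [set x | S x /\ rk x = n].
have gP x : S x -> g (rk x) = x.
  move=> Sx; rewrite /g; case: xgetP => [y _ [Sy rky]|/(_ x)[]//].
  by apply: rk_inj; rewrite ?inE.
have next H x : exists H', P H -> [/\ P H', H `<=` H' & Q x H'].
  have [PH|nPH] := pselect (P H); last by exists H.
  by have [H' H'P] := ext H x PH; exists H'.
pose nxt H x := projT1 (cid (next H x)).
have nxtP H x : P H -> [/\ P (nxt H x), H `<=` nxt H x & Q x (nxt H x)].
  exact: projT2 (cid (next H x)).
pose fix F n := if n is m.+1 then nxt (F m) (g m) else G.
have PF n : P (F n) by elim: n => // n /(nxtP _ (g n))[].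
have FF m n : (m <= n)%N -> F m `<=` F n.
  move=> /subnKC <-; elim: (n - m)%N => [|k IH]; first by rewrite addn0.
  by rewrite addnS; have [_ FS _] := nxtP _ (g (m + k)%N) (PF (m + k)%N);
    apply: subset_trans FS.
exists (\bigcup_n F n); split.
- apply/submoduleP; split.
    by exists 0%N => //; exact: (submodule0 (Psub _ PG)).
  move=> c u v [m _ Fu] [n _ Fv]; exists (maxn m n) => //.
  have [_ Fl] := (submoduleP (F (maxn m n))).1 (Psub _ (PF _)).
  by apply: Fl; [apply: FF Fu|apply: FF Fv]; rewrite ?leq_maxl ?leq_maxr.
- by move=> z Gz; exists 0%N.
- by move=> z [n _ Fz]; exists (F n).
- move=> x Sx; apply: (Qup x (F (rk x).+1)).
    by have [_ _] := nxtP _ (g (rk x)) (PF (rk x)); rewrite {1}gP.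
  by move=> z Fz; exists (rk x).+1.
Qed.

(** A single-valued total correspondence is the graph of an endomorphism. *)
Lemma total_corr_linear (U : set (A * A)) :
    submodule U -> (forall y, U (0, y) -> y = 0) ->
    (forall x, exists y, U (x, y)) ->
  exists f : {linear A -> A}, forall x y, U (x, y) <-> f x = y.
Proof.
move=> sU U0 tot; pose f x := projT1 (cid (tot x)).
have fP x : U (x, f x) := projT2 (cid (tot x)).
have Uuniq x y y' : U (x, y) -> U (x, y') -> y = y'.
  move=> Uy Uy'; apply/eqP; rewrite -subr_eq0; apply/eqP/U0.
  by have := submoduleB sU Uy Uy'; rewrite -(subrr x).
have lf : linear f.
  by move=> c x y; apply: (Uuniq (c *: x + y)) => //; apply: corr_lin.
pose F : {linear A -> A} := HB.pack f (GRing.isLinear.Build _ _ _ _ f lf).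
by exists F => x y; split=> [Uxy|<-]; [apply: Uuniq (fP x) Uxy|apply: fP].
Qed.

End Limits.

(** * Discrete valuation rings *)

Section DiscreteValuation.
Variables (R : idomainType) (p : R).

Lemma idealP (J : set R) : idealr_closed [in J] <->
  [/\ J 0, ~ J 1 & forall c x y, J x -> J y -> J (c * x + y)].
Proof.
split=> -[J0 J1 Jl]; split.
- by move: J0; rewrite inE.
- by apply: contraNnot J1; rewrite inE.
- by move=> c x y Jx Jy; have := Jl c x y; rewrite !inE; apply.
- by rewrite inE.
- by apply/negP; rewrite inE.
- by move=> c x y; rewrite !inE; apply: Jl.
Qed.

Lemma principal_idealP (x : R) : x \isn't a GRing.unit ->
  idealr_closed [in principal_ideal x].
Proof.
move=> nUx; apply/idealP; split.
- by exists 0; rewrite ?mul0r.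
- case=> r _ rx; case/negP: nUx; apply/unitrP; exists r.
  by rewrite [x * r]mulrC.
- move=> c _ _ [r _ <-] [s _ <-]; exists (c * r + s) => //.
  by rewrite mulrDl mulrA.
Qed.

(** Every proper ideal is contained in a maximal one. *)
Lemma exists_maximal_ideal (I : set R) : idealr_closed [in I] ->
  exists2 N, maximal_ideal N & I `<=` N.
Proof.
move=> /idealP[I0 I1 Il].
(* asking that I union J, not J, be an ideal covers the empty chain *)
have [F FQ totF|N [/idealP[N0 N1 Nl] Nmax]] :=
  @Zorn_bigcup R (fun J => idealr_closed [in I `|` J]).
  apply/idealP; split.
  - by left.
  - case=> [//|[J FJ J1]]; have /idealP[_ + _] := FQ J FJ; apply; by right.
  - move=> c x y Ux Uy.
    have mem z : (I `|` \bigcup_(X in F) X) z ->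
        I z \/ exists2 J, F J & (I `|` J) z.
      by case=> [?|[J FJ Jz]]; [left|right; exists J => //; right].
    have up (J : set R) z : F J -> (I `|` J) z -> (I `|` \bigcup_(X in F) X) z.
      by move=> FJ [Iz|Jz]; [left|right; exists J].
    have lin J : F J -> (I `|` J) x -> (I `|` J) y ->
        (I `|` \bigcup_(X in F) X) (c * x + y).
      by move=> FJ Jx Jy; apply: (up J) => //; have /idealP[_ _] := FQ J FJ; apply.
    case: (mem _ Ux) (mem _ Uy) => [Ix|[J FJ Jx]] [Iy|[H FH Hy]].
    + by left; apply: Il.
    + by apply: (lin H) => //; left.
    + by apply: (lin J) => //; left.
    + case: (totF J H FJ FH) => JH.
        by apply: (lin H) => //; case: Jx => [?|/JH]; [left|right].
      by apply: (lin J) => //; case: Hy => [?|/JH]; [left|right].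
exists (I `|` N); last by move=> x; left.
split; first by apply/idealP.
move=> J Jid NJ; apply/seteqP; split=> // x Jx; right.
apply: contrapT => nNx; apply: (Nmax J); last first.
  suff -> : I `|` J = J by [].
  by apply/seteqP; split=> z; [case=> // Iz; apply: NJ; left|right].
by split=> [z Nz|JN]; [apply: NJ; right|apply: nNx; apply: JN].
Qed.

Hypothesis R_dvr : is_dvr R.
Hypothesis p_gen : maximal_ideal (principal_ideal p).

Lemma dvr_local (c : R) : ~ principal_ideal p c -> c \is a GRing.unit.
Proof.
move=> npc; apply: contrapT => /negP/principal_idealP/exists_maximal_ideal.
move=> [N maxN cN]; have [_ [M [_ _ uniqM]]] := R_dvr; apply: npc.
by rewrite (uniqM _ p_gen) -(uniqM _ maxN); apply: cN; exists 1; rewrite ?mul1r.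
Qed.

Lemma dvr_p_neq0 : p != 0.
Proof.
apply/negP => /eqP p0; have [_ [M [_ M0 uniqM]]] := R_dvr.
apply: M0; rewrite -(uniqM _ p_gen) p0; apply/seteqP; split=> [_ [r _ <-]|x ->].
  by rewrite mulr0.
by exists 0; rewrite ?mul0r.
Qed.

(** By principality the intersection of the ideals [(p ^+ n)] is generated by
    some [x]; as [x = p y] with [y] again in the intersection, it is zero. *)
Lemma dvr_separated (r : R) : (forall n, exists y, r = y * p ^+ n) -> r = 0.
Proof.
move=> rI; pose I := [set r : R | forall n, exists y, r = y * p ^+ n].
have /idealP[_ np1 _] := p_gen.1.
have Iid : idealr_closed [in I].
  apply/idealP; split.
  - by move=> n; exists 0; rewrite mul0r.
  - by move=> /(_ 1%N)[y yp]; apply: np1; exists y; rewrite // -[RHS]yp.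
  - move=> c u v Iu Iv n; have [y ->] := Iu n; have [z ->] := Iv n.
    by exists (c * y + z); rewrite mulrDl mulrA.
have [x IE] := R_dvr.1 _ Iid.
have Ix : I x by rewrite IE; exists 1; rewrite ?mul1r.
have [y xE] := Ix 1%N; rewrite expr1 in xE.
have : I y.
  move=> n; have [z zE] := Ix n.+1; exists z.
  by apply: (mulIf dvr_p_neq0); rewrite -xE zE exprSr mulrA.
rewrite IE => -[c _ cE].
have /eqP : x * (1 - c * p) = 0.
  by rewrite mulrBr mulr1 {1}xE -cE mulrA [x * c]mulrC subrr.
rewrite mulf_eq0 subr_eq0 => /orP[/eqP x0|/eqP cp].
  have : I r := rI; rewrite IE x0 => -[d _ <-]; exact: mulr0.
by case: np1; exists c.
Qed.

Lemma dvr_factor (r : R) : r != 0 ->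
  exists2 c, c \is a GRing.unit & exists n, r = c * p ^+ n.
Proof.
move=> /eqP r0; have [n nr] : exists n, ~ exists y, r = y * p ^+ n.
  by apply/existsNP => /dvr_separated.
elim: n nr => [[]|n IH nr]; first by exists r; rewrite expr0 mulr1.
have [[y yE]|/IH//] := pselect (exists y, r = y * p ^+ n).
exists y; last by exists n.
by apply: dvr_local => -[z _ zE]; apply: nr; exists z; rewrite exprS mulrA zE.
Qed.

End DiscreteValuation.

(** * Degenerations and orbits *)

Section Orbits.
Variables (R : idomainType) (p : R) (A : lmodType R).
Hypothesis R_dvr : is_dvr R.
Hypothesis p_gen : maximal_ideal (principal_ideal p).
Hypothesis A_reduced : reduced A.
Hypothesis A_cg : countably_generated A.
Hypothesis A_torsion : torsion A.
Implicit Types a b x y : A.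

Let p_local := dvr_local R_dvr p_gen.
Let p_factor := dvr_factor R_dvr p_gen.

Lemma torsion_expr x : exists n, p ^+ n *: x = 0.
Proof.
have [r /p_factor[c Uc [n ->]] rx] := A_torsion x; exists n.
by rewrite -[LHS]scale1r -(mulVr Uc) -scalerA [c *: _]scalerA rx scaler0.
Qed.

Lemma monotone_corr_pair a b :
  (forall i, height_le p (p ^+ i *: a) (p ^+ i *: b)) ->
  monotone_corr p (adjoin [set 0] (a, b)).
Proof.
move=> hab; split.
  have [k pka] := torsion_expr a.
  apply: (finite_length_adjoinX (n := k)); first exact: finite_length0.
  have pkb : p ^+ k *: b = 0.
    apply: (stage_sep p_factor A_reduced) => alpha.
    by apply: (hab k); rewrite pka; apply: stage0.
  exact: (congr2 pair pka pkb).
move=> x y [c /eqP]; rewrite subr_eq0 => /eqP[-> ->].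
have [->|/p_factor[d Ud [n ->]]] := eqVneq c 0; first by rewrite !scale0r.
move=> alpha; rewrite -!scalerA => /(stage_unit Ud)/hab; exact: stageZ.
Qed.

Lemma monotone0 (G : set (A * A)) y : monotone p G -> G (0, y) -> y = 0.
Proof.
move=> mG /mG h; apply: (stage_sep p_factor A_reduced) => alpha.
by apply: h; apply: stage0.
Qed.

Lemma full_of_generators (S B : set A) :
  (forall B, submodule B -> S `<=` B -> B = [set: A]) ->
  submodule B -> S `<=` B -> forall x, B x.
Proof. by move=> gen sB SB x; rewrite (gen B sB SB). Qed.

Lemma submodule_domain (G : set (A * A)) :
  submodule G -> submodule [set x | exists y, G (x, y)].
Proof.
move=> sG; apply/submoduleP; split; first by exists 0; exact: (submodule0 sG).
by move=> c x y [u xu] [v yv]; exists (c *: u + v); apply: corr_lin.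
Qed.

Lemma degeneratesP a b : degenerates a b <->
  forall i, height_le p (p ^+ i *: a) (p ^+ i *: b).
Proof.
split=> [[f <-] i alpha|/monotone_corr_pair hG].
  by rewrite -linearZ; apply: stage_linear.
have [S [cS gen]] := A_cg.
have [|||U [sU GU UP US]] := chain_union
  (Q := fun x H => exists y, H (x, y)) cS _ _ _ hG.
- by move=> H [fH _]; apply: finite_length_submodule fH.
- by move=> x H H' [y Hy] HH'; exists y; apply: HH'.
- move=> H x.
  exact: (monotone_extend p_local p_factor A_reduced torsion_expr).
have [||f fP] := total_corr_linear sU.
- by move=> y /UP[H [_ mH]]; apply: monotone0.
- exact: (full_of_generators gen (submodule_domain sU)).
by exists f; apply/fP/GU/adjoin_mem/submodule_set0.
Qed.

Lemma same_orbitP a b : same_orbit a b <->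
  forall i, height_le p (p ^+ i *: a) (p ^+ i *: b) /\
            height_le p (p ^+ i *: b) (p ^+ i *: a).
Proof.
split=> [[f [g fK gK] fab] i|hab].
  split; first by apply: (degeneratesP a b).1 i; exists f.
  apply: (degeneratesP b a).1 i.
  exists (HB.pack_for {linear A -> A} g
    (GRing.isLinear.Build _ _ _ _ g (can2_linear fK gK))).
  by rewrite -fab /= fK.
have [fG mG] : monotone_corr p (adjoin [set 0] (a, b)).
  by apply: monotone_corr_pair => i; case: (hab i).
have [_ mcG] : monotone_corr p (adjoin [set 0] (b, a)).
  by apply: monotone_corr_pair => i; case: (hab i).
have hG : height_preserving_corr p (adjoin [set 0] (a, b)).
  split=> // y x [c /eqP]; rewrite subr_eq0 => /eqP[-> ->].
  by apply: mcG; exists c; rewrite subrr.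
have [S [cS gen]] := A_cg.
have [|||U [sU GU UP US]] := chain_union
  (Q := fun x H => (exists y, H (x, y)) /\ exists y, H (y, x)) cS _ _ _ hG.
- by move=> H [fH _ _]; apply: finite_length_submodule fH.
- by move=> x H H' [[y Hy] [z Hz]] HH'; split; [exists y|exists z]; apply: HH'.
- move=> H x hH; have [H' [hH' HH' H'x xH']] :=
    height_preserving_extend p_local p_factor A_reduced torsion_expr x hH.
  by exists H'.
have [||f fP] := total_corr_linear sU.
- by move=> y /UP[H [_ mH _]]; apply: monotone0.
- apply: (full_of_generators gen (submodule_domain sU)) => x Sx.
  by have [] := US x Sx.
have surj : forall y, exists x, U (x, y).
  apply: (full_of_generators gen (submodule_domain (submodule_converse sU))).
  by move=> x Sx; have [] := US x Sx.
exists f; last by apply/fP/GU/adjoin_mem/submodule_set0.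
pose g y := projT1 (cid (surj y)).
have gK : cancel g f by move=> y; apply/fP; exact: projT2 (cid (surj y)).
exists g => // x; apply/eqP; rewrite -subr_eq0; apply/eqP.
have /fP/UP[H [_ _ mH]] : f (g (f x) - x) = 0 by rewrite linearB gK subrr.
exact: (monotone0 mH).
Qed.

End Orbits.

Theorem theorem14 (R : idomainType) (p : R) (A : lmodType R)
    (R_dvr : is_dvr R) (p_gen : maximal_ideal (principal_ideal p))
    (A_reduced : reduced A) (A_cg : countably_generated A)
    (A_torsion : torsion A) (a b : A) :
  (degenerates a b <-> dominates (ulm_sequence p b) (ulm_sequence p a)) /\
  (same_orbit a b <-> coincide (ulm_sequence p a) (ulm_sequence p b)).
Proof.
have p_factor := dvr_factor R_dvr p_gen.
split.
  rewrite (degeneratesP R_dvr p_gen A_reduced A_cg A_torsion).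
  by split=> h i; apply/(hle_heightP p_factor A_reduced)/h.
rewrite (same_orbitP R_dvr p_gen A_reduced A_cg A_torsion).
by split=> h i; apply/(heq_heightP p_factor A_reduced)/h.
Qed.
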